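(* The sequence of Cayley graphs $\{\Gamma(Sym_n,\{t,c\})\}_n$ cannot contain coarsely an unbounded sequence of bounded degree expanders. That is, there is a universal constant $C>0$ such that the following holds. Given two increasing functions $\alpha,\beta:[0,\infty)\to[0,\infty)$ with $\lim_{s\to\infty}\alpha(s)=\infty$, and a finite graph $\Gamma$ with (normalized) spectral gap $1-\lambda$ and maximum degree $\Delta$, if there exists (for some $n\in\mathbb{N}$) a map $f:\Gamma\to Sym_n$ with $$\alpha\big(d_\Gamma(u,v)\big)\le d_{\{c,t\}}\big(f(u),f(v)\big)\le\beta\big(d_\Gamma(u,v)\big)\quad\text{for all }u,v\in V(\Gamma),$$ then the number of vertices of $\Gamma$ is bounded: $$|V(\Gamma)|\le\Delta^{\alpha^{-1}\left(C\beta(1)/(1-\lambda)\right)}.$$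
   Context: $Sym_n$ is the symmetric group on $\mathbb{Z}/n=\{0,1,\ldots,n-1\}$, $t=(0\,1)$ is the transposition of the first two elements and $c=(0\,1\,2\ldots n-1)$ is the cyclic permutation. $\Gamma(Sym_n,\{t,c\})$ is the Cayley graph with vertex set $Sym_n$ and edges joining $\pi$ to $t\pi$ and to $c\pi$ for all $\pi\in Sym_n$, and $d_{\{c,t\}}$ is its shortest path metric (the word metric on $Sym_n$). For a graph $\Gamma$, $V(\Gamma)$ is its vertex set, $d_\Gamma$ is its shortest path metric, and its normalized spectral gap is $1-\lambda$, where $\lambda$ is the second largest eigenvalue of the normalized adjacency matrix (the transition matrix of the simple random walk on $\Gamma$). $\alpha^{-1}$ denotes the inverse function of $\alpha$.
   Formalization: In the bound, the inverse of α is the least integer k with α(k) at least the argument (rounded up), since the real inverse fails for the triangle; Δ ≥ 2 is assumed, excluding only the single edge K_2 where the bound fails; β(1) > 0 is assumed. *)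

(* Defs.v *)
(* MathComp / MathComp-Analysis. *)
From HB Require Import structures.
From mathcomp Require Import all_boot all_order all_algebra all_fingroup.
From mathcomp Require Import all_classical all_reals all_analysis.
Set Implicit Arguments.
Unset Strict Implicit.
Unset Printing Implicit Defensive.
Import Order.TTheory GRing.Theory Num.Theory.
Import numFieldNormedType.Exports.
Local Open Scope classical_set_scope.
Local Open Scope ring_scope.

Definition simple_graph (T : finType) (e : rel T) : Prop :=
  symmetric e /\ irreflexive e.

Definition connected_graph (T : finType) (e : rel T) : Prop :=
  forall x y : T, connect e x y.

Definition degree (T : finType) (e : rel T) (x : T) : nat :=
  #|[set y | e x y]|.

Definition max_degree (T : finType) (e : rel T) : nat :=
  (\max_(x : T) degree e x)%N.

(* A walk of length k from x to y is a k-tuple of successive vertices after x,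
   ending at y. Shortest walks have length < #|T|; the value is #|T| when y is
   not reachable from x. *)
Definition graph_dist (T : finType) (e : rel T) (x y : T) : nat :=
  find (fun k => [exists p : k.-tuple T, path e x p && (last x p == y)])
       (iota 0 #|T|).

Definition transition_matrix (R : realType) (T : finType) (e : rel T) :
    'M[R]_#|T| :=
  \matrix_(i, j) ((e (enum_val i) (enum_val j))%:R
                    / (degree e (enum_val i))%:R).

(* The eigenvalues are listed with multiplicity, in nonincreasing order; there
   is no second largest eigenvalue in dimension < 2. *)
Definition second_largest_eigenvalue (R : realType) (n : nat) (A : 'M[R]_n)
    (lam : R) : Prop :=
  exists s : seq R,
    [/\ char_poly A = \prod_(x <- s) ('X - x%:P),
        sorted >=%R s,
        (1 < size s)%N
      & lam = nth 0 s 1].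

(* Sym_n is 'S_n.+2, as t = (0 1) requires at least two points. *)
Definition sym_t (n : nat) : 'S_n.+2 := tperm ord0 (lift ord0 ord0).

Definition sym_c (n : nat) : 'S_n.+2 := perm (@ordS_inj n.+2).

(* In MathComp (s * t) x = t (s x), so the composite "t after s", usually
   written t s, is (s * t)%g. *)
Definition cayley_tc (n : nat) : rel 'S_n.+2 := fun s s' =>
  [|| s' == (s * sym_t n)%g, s' == (s * sym_c n)%g,
      s == (s' * sym_t n)%g | s == (s' * sym_c n)%g].

(* Functions [0,oo) -> [0,oo) are functions on R used only on [0,oo);
   "increasing" is taken in the weak sense. *)
Definition increasing_nonneg (R : realType) (h : R -> R) : Prop :=
  (forall x, 0 <= x -> 0 <= h x) /\
  (forall x y, 0 <= x -> x <= y -> h x <= h y).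

Definition coarse_map_to_sym (R : realType) (alpha beta : R -> R)
    (T : finType) (e : rel T) (n : nat) (f : T -> 'S_n.+2) : Prop :=
  forall u v : T,
    alpha (graph_dist e u v)%:R <= (graph_dist (@cayley_tc n) (f u) (f v))%:R
    /\ (graph_dist (@cayley_tc n) (f u) (f v))%:R
         <= beta (graph_dist e u v)%:R.

(* The inverse of alpha along integer distances: the least natural number k
   with y <= alpha k. The values of alpha between integers are irrelevant to a
   coarse embedding of a graph, whose distances are integers, and a bound in
   terms of a real-valued inverse would depend on them. When alpha is strictly
   increasing this is the inverse function of alpha rounded up to an integer
   (dist_inverse_ceil), so it is the inverse of alpha at y = alpha k. *)
Definition dist_inverse (R : realType) (alpha : R -> R) (y : R) : R :=
  inf [set k%:R | k in [set k : nat | y <= alpha k%:R]].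

Lemma dist_inverse_ceil (R : realType) (alpha : R -> R) (s : R) :
  (forall x y, 0 <= x -> x < y -> alpha x < alpha y) -> 0 <= s ->
  dist_inverse alpha (alpha s) = (Num.ceil s)%:~R.
Proof.
move=> inc s0.
have leE (k : nat) : (alpha s <= alpha k%:R) = (s <= k%:R).
  apply/idP/idP; last first.
    by rewrite le_eqVlt => /predU1P[->//|/(inc _ _ s0)/ltW].
  by apply: contraTT; rewrite -!ltNge => /(inc _ _ (ler0n R k)).
have [m mE] : exists m : nat, Num.ceil s = m%:Z.
  have : 0 <= Num.ceil s by rewrite -(ceil0 R) le_ceil.
  by case: (Num.ceil s) => // m _; exists m.
have sm : s <= m%:R by have := ceil_ge s; rewrite mE.
have lb : lbound [set k%:R | k in [set k : nat | alpha s <= alpha k%:R]]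
            (m%:R : R).
  move=> _ [k /= + <-]; rewrite leE => sk.
  by rewrite ler_nat -lez_nat -mE ceil_le_int.
rewrite mE; apply/eqP; rewrite eq_le; apply/andP; split.
  by apply: ge_inf; [exists m%:R | exists m => //=; rewrite leE].
by apply: lb_le_inf => //; exists m%:R; exists m => //=; rewrite leE.
Qed.

(* Main.v *)
(** For functions on the vertices with values in a finite set, the spectral gap
    bounds the frequency of [g u != g v] over stationary pairs by its frequency
    over edges, divided by [1 - lam]. The kernel below is a weighted count of
    such disagreements on [Sym_n]. It compares the cyclic order of all triples
    of labels and, at a scale [m], the labels lying within [m] of the head
    together with the long arc of labels starting at each of them. Both counts
    change little under a generator. Conversely, when the kernel is below [n m],
    either [n = O(m)] or the two arrangements share such an arc, so after a
    rotation of length O(m) they differ only on a window of O(m) positions with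
    O(m) inversions, and selection sort joins them by a walk of length O(m).
    As a quarter of the stationary pairs are at distance at least [k] in the
    graph, one of these pairs has images at distance O(beta(1)/(1 - lam)). *)
Require Import Defs.
From HB Require Import structures.
From mathcomp Require Import all_boot all_order all_algebra all_fingroup.
From mathcomp Require Import all_classical all_reals all_analysis.
From mathcomp Require Import zify ring lra complex spectral.
Set Implicit Arguments.
Unset Strict Implicit.
Unset Printing Implicit Defensive.
Import Order.TTheory GRing.Theory Num.Theory.
Import numFieldNormedType.Exports.
Local Open Scope ring_scope.

(** * Walks and Hamming distances *)

Section Walks.
Local Open Scope nat_scope.
Variables (T : finType) (e : rel T).

(** Distance bounds are built as walks: these concatenate and reverse freely, whereas [graph_dist]
    carries its cutoff at [#|T|]. *)
Definition within (x y : T) (k : nat) : Prop :=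
  exists p : seq T, [/\ path e x p, last x p = y & size p <= k].

Lemma within0 x k : within x x k.
Proof. by exists [::]. Qed.

Lemma within1 x y k : e x y -> 0 < k -> within x y k.
Proof. by move=> exy k0; exists [:: y]; rewrite /= exy. Qed.

Lemma within_trans y x z j k :
  within x y j -> within y z k -> within x z (j + k).
Proof.
move=> [p [px py sp]] [q [qy qz sq]]; exists (p ++ q).
by rewrite cat_path px py last_cat py size_cat leq_add.
Qed.

Lemma within_le x y j k : within x y j -> j <= k -> within x y k.
Proof. by move=> [p [px py sp]] jk; exists p; rewrite (leq_trans sp). Qed.

Lemma within_sym x y k : symmetric e -> within x y k -> within y x k.
Proof.
move=> sym [p [px <- sp]]; exists (rev (belast x p)); split.
- by rewrite rev_path (eq_path (e' := e)) // => a b; rewrite sym.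
- by case: p {px sp} => [|a p] //=; rewrite rev_cons last_rcons.
- by rewrite size_rev size_belast.
Qed.

Lemma graph_dist_le x y k : within x y k -> graph_dist e x y <= k.
Proof.
move=> [p [px py sp]]; apply: leq_trans sp; rewrite leqNgt.
apply/negP => lt; have sz : size p < #|T|.
  by apply: leq_trans lt _; rewrite -[leqRHS](size_iota 0) find_size.
have := before_find 0 lt; rewrite nth_iota // add0n => /existsP[].
by exists (in_tuple p); rewrite /= px py eqxx.
Qed.

Lemma graph_distP x y : connect e x y -> within x y (graph_dist e x y).
Proof.
case/connectP => p px ->; case/shortenP: px => q qx uq _.
have szq : size q < #|T|.
  by rewrite -[(size q).+1]/(size (x :: q)) -(card_uniqP uq) max_card.
have /(nth_find 0) : has (fun k => [exists r : k.-tuple T,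
    path e x r && (last x r == last x q)]) (iota 0 #|T|).
  apply/hasP; exists (size q); first by rewrite mem_iota.
  by apply/existsP; exists (in_tuple q); rewrite /= qx eqxx.
rewrite -/(graph_dist e x (last x q)).
set d := graph_dist _ _ _ => + .
have szd : d <= size q by apply: graph_dist_le; exists q.
rewrite nth_iota ?(leq_ltn_trans szd) // add0n => /existsP[r /andP[rx /eqP rq]].
by exists r; rewrite rx rq size_tuple.
Qed.

Lemma graph_dist0 x : graph_dist e x x = 0.
Proof. by apply/eqP; rewrite -leqn0 graph_dist_le //; exact: within0. Qed.

Lemma graph_dist_edge x y z : connect e x y -> e y z ->
  graph_dist e x z <= (graph_dist e x y).+1.
Proof.
move=> cxy eyz; rewrite -addn1; apply: graph_dist_le.
by apply: within_trans (graph_distP cxy) _; exact: within1.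
Qed.

Lemma graph_dist_pred x y : connect e x y -> x != y ->
  exists2 z, e z y & graph_dist e x z < graph_dist e x y.
Proof.
move=> /graph_distP [p]; case/lastP: p => [|p z] [].
  by move=> _ /= ->; rewrite eqxx.
rewrite rcons_path last_rcons size_rcons => /andP[px ez] <- sp _.
exists (last x p) => //; apply: leq_trans sp.
by rewrite ltnS graph_dist_le //; exists p.
Qed.

End Walks.

Section Hamming.
Local Open Scope nat_scope.
Variables (I : finType) (X : eqType).
Implicit Types f g h : I -> X.

Definition hamming f g : nat := #|[set i | f i != g i]|.

Lemma hamming_sym f g : hamming f g = hamming g f.
Proof. by rewrite /hamming; apply: eq_card => i; rewrite !inE eq_sym. Qed.

Lemma hamming_trans g f h : hamming f h <= hamming f g + hamming g h.
Proof.
rewrite /hamming; apply: leq_trans (leq_card_setU _ _).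
apply/subset_leq_card/fintype.subsetP => i.
by rewrite !inE; case: (f i =P g i) => // ->.
Qed.

Lemma hamming_eq0 f g : f =1 g -> hamming f g = 0.
Proof. by rewrite /hamming => fg; apply: eq_card0 => i; rewrite inE fg eqxx. Qed.

End Hamming.

(** * The word metric on the symmetric group *)

Section CayleySym.
Local Open Scope nat_scope.
Variable n : nat.
Local Notation N := n.+2.
Local Notation Sym := 'S_N.
Local Notation cay := (@cayley_tc n).
Local Notation c := (sym_c n).
Local Notation t := (sym_t n).
Implicit Types (s u v : Sym) (x y : 'I_N).

Lemma cayley_tc_sym : symmetric cay.
Proof.
by move=> s u; rewrite /cayley_tc; apply/or4P/or4P => -[] h;
  [apply: Or43|apply: Or44|apply: Or41|apply: Or42
  |apply: Or43|apply: Or44|apply: Or41|apply: Or42].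
Qed.

Lemma cayley_tcE s u : cay s u ->
  [\/ u = (s * t)%g, u = (s * c)%g | s = (u * c)%g].
Proof.
case/or4P => /eqP ->; [exact: Or31|exact: Or32| |exact: Or33].
by apply: Or31; rewrite -mulgA tperm2 mulg1.
Qed.

Lemma val_c x : c x = (x.+1 %% N) :> nat.
Proof. by rewrite permE. Qed.

Lemma val_cX k x : (c ^+ k)%g x = (x + k) %% N :> nat.
Proof.
elim: k => [|k IH]; first by rewrite expg0 perm1 addn0 modn_small.
by rewrite expgSr permM val_c IH -addn1 modnDml addn1 addnS.
Qed.

Lemma val_t x : t x = (if x == 0 :> nat then 1 else if x == 1 :> nat then 0 else x) :> nat.
Proof.
rewrite permE /=; case: eqP => [->//|x0].
case: ifP => [/eqP ->|].
  by case: eqP => // -[].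
move=> xl; case: eqP => x0'; first by case: x0; exact: val_inj.
by case: eqP => // x1; move: xl; rewrite -val_eqE /= x1.
Qed.

Lemma within_c s k : within cay s (s * c ^+ k)%g k.
Proof.
elim: k => [|k IH]; first by rewrite expg0 mulg1; exact: within0.
have st : within cay (s * c ^+ k)%g (s * c ^+ k.+1)%g 1.
  by apply: within1 => //; rewrite /cayley_tc expgSr mulgA eqxx orbT.
by have := within_trans IH st; rewrite addn1.
Qed.

Lemma within_cV s k : within cay s (s * c ^- k)%g k.
Proof.
apply: (within_sym cayley_tc_sym); rewrite -{2}[s](mulgKV (c ^+ k)%g).
exact: within_c.
Qed.

Lemma within_t s : within cay s (s * t)%g 1.
Proof. by apply: within1 => //; rewrite /cayley_tc eqxx. Qed.

(* The group only sees an arrangement up to rotation; [at_head s p] is [s] seen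
   from a head standing at position [p], where [t] swaps positions [p], [p+1]. *)
Definition at_head s p : Sym := (s * c ^- p)%g.

Lemma at_head_up s p k : within cay (at_head s p) (at_head s (p + k)) k.
Proof. by rewrite /at_head addnC expgD invMg mulgA; exact: within_cV. Qed.

Lemma at_head_down s p k : within cay (at_head s (p + k)) (at_head s p) k.
Proof. by apply: (within_sym cayley_tc_sym); exact: at_head_up. Qed.

Lemma at_head_swap s x y : s y = (s x).+1 :> nat ->
  within cay (at_head s (s x)) (at_head (s * tperm (s x) (s y))%g (s x).+1) 2.
Proof.
move=> sy; have h := within_t (at_head s (s x)).
have tE : (at_head s (s x) * t = at_head (s * tperm (s x) (s y)) (s x))%g.
  have -> : tperm (s x) (s y) = (t ^ (c ^+ s x))%g.
    rewrite tpermJ; congr tperm; apply: ord_inj; rewrite val_cX /=.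
      by rewrite add0n modn_small.
    rewrite (_ : bump 0 0 + s x = s y) ?modn_small //.
  by rewrite /at_head conjgE !mulgA mulgK.
rewrite tE in h.
by have := within_trans h (at_head_up _ (s x) 1); rewrite addn1.
Qed.

Definition inversions u v : {set 'I_N * 'I_N} :=
  [set p | (u p.1 < u p.2) && (v p.2 < v p.1)].

Lemma inversions_swap s v x y : s y = (s x).+1 :> nat -> v y < v x ->
  #|inversions (s * tperm (s x) (s y))%g v| < #|inversions s v|.
Proof.
move=> sy vyx; apply: proper_card; apply/properP; split; last first.
  exists (x, y); rewrite inE /= ?sy ?ltnSn //.
  by rewrite !permM tpermL tpermR sy ltnNge leqnSn.
apply/fintype.subsetP => -[a b]; rewrite !inE /= !permM => /andP[+ vba].
rewrite vba andbT.
case: tpermP => [/perm_inj ea|/perm_inj ea|ax ay];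
  case: tpermP => [/perm_inj eb|/perm_inj eb|bx b_y];
  subst; rewrite ?ltnn //; try lia.
- by move=> h; suff : s b <> s y :> nat by [lia]; move/ord_inj.
- by move=> h; suff : s a <> s x :> nat by [lia]; move/ord_inj.
Qed.

(** The label that [v] puts at position [s x] is also put there by [s], so injectivity of [s] makes
    it [x]. *)
Lemma agree_above w s v x : (forall y, w <= v y -> s y = v y) ->
  w <= s x -> s x = v x.
Proof.
move=> ag ws; pose y := (v^-1)%g (s x).
have vy : v y = s x by rewrite permKV.
by have /perm_inj yx : s y = s x by [rewrite ag vy]; rewrite -[in RHS]yx vy.
Qed.

(* Selection sort with the head travelling down: the label destined to the top
   position of the window is carried there by adjacent swaps, each of which
   removes one inversion. *)
Lemma sort_window w s v :
  w <= N -> (forall x, w <= v x -> s x = v x) ->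
  within cay (at_head s w) v (w + 3 * #|inversions s v|).
Proof.
elim: w s => [|w IH] s wn ag.
  have -> : s = v by apply/permP => x; exact: ag.
  rewrite /at_head expg0 invg1 mulg1.
  by apply: (@within_le _ _ _ _ 0); first exact: within0.
pose x := (v^-1)%g (Ordinal wn); have vx : v x = w :> nat by rewrite permKV.
have sxw u : (forall y, w < v y -> u y = v y) -> u x <= w.
  by move=> agu; rewrite leqNgt; apply/negP => h; move: (h);
    rewrite (agree_above agu h) vx ltnn.
(* Each swap removes an inversion, worth 3 steps: one for [t], one for the step up that follows, and
   one, recorded by [+ k], for the head's earlier descent to [x]. *)
have carry k u : (forall y, w < v y -> u y = v y) -> u x + k = w ->
    exists2 m, within cay (at_head u (u x)) v m & m + k <= w + 3 * #|inversions u v|.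
  elim: k u => [|k IHk] u agu.
    rewrite addn0 => ux; exists (w + 3 * #|inversions u v|); last by rewrite addn0.
    rewrite ux; apply: IH (ltnW wn) _ => y.
    rewrite leq_eqVlt => /predU1P[vy|]; last exact: agu.
    have -> : y = x by apply: (@perm_inj _ v); apply: val_inj; rewrite /= vx.
    by apply: val_inj; rewrite /= vx.
  move=> uxk; have pN : (u x).+1 < N by lia.
  pose y := (u^-1)%g (Ordinal pN).
  have uy : u y = (u x).+1 :> nat by rewrite permKV.
  have vyx : v y < v x.
    rewrite vx ltnNge leq_eqVlt; apply/negP => /predU1P[vy|h].
      have /perm_inj e : v y = v x by apply: val_inj; rewrite /= vx.
      by move: uy; rewrite e; lia.
    have e := agu y h; by move: h; rewrite -e uy; lia.
  have inv := inversions_swap uy vyx.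
  have [||m wm mk] := IHk (u * tperm (u x) (u y))%g.
  - move=> z vz; rewrite permM (agu z vz) tpermD //; apply/eqP => e.
    + by move: vz; rewrite -e; lia.
    + by move: vz; rewrite -e; lia.
  - by rewrite permM tpermL uy; lia.
  rewrite permM tpermL uy in wm.
  exists (2 + m); last by lia.
  by apply: within_trans wm; exact: at_head_swap.
have [k ke] : exists k, s x + k = w by exists (w - s x); have := sxw _ ag; lia.
have [m wm mk] := carry k s ag ke.
apply: (@within_le _ _ _ _ (k.+1 + m)); last by lia.
apply: within_trans wm; rewrite -ke -addnS; exact: at_head_down.
Qed.


(* Reading the cycle upwards from [x], [y] comes strictly before [z]. *)
Definition cyc (x y z : nat) : bool :=
  [|| x <= y < z, y < z < x | z < x <= y].

Definition orientation s (q : 'I_N * 'I_N * 'I_N) : bool :=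
  cyc (s q.1.1) (s q.1.2) (s q.2).

(* The labels on the [N - (m + 1)] positions from that of [x] on. When [x] is at
   a position in [2, m + 2) this arc avoids positions 0 and 1, hence is not
   affected by [t]. *)
Definition arc m s x : {ffun 'I_N -> 'I_N} :=
  [ffun p : 'I_N => if m + 1 + p < N then (s^-1)%g ((c ^+ p)%g (s x)) else x].

Definition marked_arc m s x : option {ffun 'I_N -> 'I_N} :=
  if 2 <= s x < m + 2 then Some (arc m s x) else None.

(** * Effect of the generators on orientations and arcs *)

Lemma orientation_c s : orientation (s * c)%g =1 orientation s.
Proof.
have valE (x : 'I_N) : c x = (if x.+1 == N then 0 else x.+1) :> nat.
  rewrite val_c; case: eqP => [->|]; first by rewrite modnn.
  by move=> h; rewrite modn_small //; have := ltn_ord x; lia.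
move=> [[j a] b]; rewrite /orientation /= !permM !valE.
move: (ltn_ord (s j)) (ltn_ord (s a)) (ltn_ord (s b)); rewrite /cyc.
by do 3 case: eqP; lia.
Qed.

Lemma orientation_cX s k : orientation (s * c ^+ k)%g =1 orientation s.
Proof.
elim: k => [|k IH] q; first by rewrite expg0 mulg1.
by rewrite expgSr mulgA orientation_c.
Qed.

(** Positions 0 and 1 are adjacent on the cycle, so exchanging them can reorder a triple only if it
    contains both. *)
Lemma cyc_transpose (f := fun x : nat => if x == 0 then 1 else if x == 1 then 0 else x)
    (x y z : nat) :
  cyc (f x) (f y) (f z) != cyc x y z ->
  x = 0 /\ y = 1 \/ x = 1 /\ y = 0 \/ x = 0 /\ z = 1 \/ x = 1 /\ z = 0 \/
  y = 0 /\ z = 1 \/ y = 1 /\ z = 0.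
Proof.
rewrite /cyc /f.
by case: x => [|[|x]]; case: y => [|[|y]]; case: z => [|[|z]] /=; lia.
Qed.

(** The labels [X] and [Y] at positions 0 and 1 must fill two of the three slots of an affected
    triple: six ordered ways, with the third slot free. *)
Lemma hamming_orientation_t s :
  hamming (orientation (s * t)%g) (orientation s) <= 6 * N.
Proof.
pose X := (s^-1)%g (inord 0); pose Y := (s^-1)%g (inord 1).
have eX x : s x = 0 :> nat -> x = X.
  by move=> h; apply: (@perm_inj _ s); rewrite permKV; apply: ord_inj; rewrite inordK.
have eY x : s x = 1 :> nat -> x = Y.
  by move=> h; apply: (@perm_inj _ s); rewrite permKV; apply: ord_inj; rewrite inordK.
pose A := [set (X, Y, z) | z in 'I_N] :|: [set (Y, X, z) | z in 'I_N] :|: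
  ([set (X, z, Y) | z in 'I_N] :|: [set (Y, z, X) | z in 'I_N]) :|:
  ([set (z, X, Y) | z in 'I_N] :|: [set (z, Y, X) | z in 'I_N]).
rewrite /hamming; apply: (@leq_trans #|A|); last first.
  have im (f : 'I_N -> 'I_N * 'I_N * 'I_N) : #|[set f z | z in 'I_N]| <= N.
    by apply: leq_trans (leq_imset_card _ _) _; rewrite card_ord.
  have U (B C : {set 'I_N * 'I_N * 'I_N}) b d : #|B| <= b -> #|C| <= d -> #|B :|: C| <= b + d.
    by move=> hB hC; apply: leq_trans (leq_card_setU _ _) _; exact: leq_add.
  have -> : 6 * N = N + N + (N + N) + (N + N) by lia.
  pose U2 f g := U _ _ _ _ (im f) (im g).
  exact: U (U _ _ _ _ (U2 _ _) (U2 _ _)) (U2 _ _).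
apply/subset_leq_card/fintype.subsetP => -[[j a] b]; rewrite inE /orientation /= !permM !val_t.
move/cyc_transpose.
case=> [[/eX -> /eY ->]|[[/eY -> /eX ->]|[[/eX -> /eY ->]|[[/eY -> /eX ->]|
  [[/eX -> /eY ->]|[/eY -> /eX ->]]]]]];
  by rewrite !inE ?imset_f ?orbT.
Qed.

(** A rotation leaves the arc of every label unchanged; only the label entering the window at
    position 2 and the one leaving it can change their mark. *)
Lemma hamming_marked_arc_c m s :
  hamming (marked_arc m (s * c)%g) (marked_arc m s) <= 2.
Proof.
(* When the window reaches past the last position, labels leave it by wrapping from [n.+1] to 0,
   hence the minimum. *)
pose X := (s^-1)%g (inord 1); pose Y := (s^-1)%g (inord (minn (m + 1) n.+1)).
have eX x : s x = 1 :> nat -> x = X.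
  by move=> h; apply: (@perm_inj _ s); rewrite permKV; apply: ord_inj; rewrite inordK.
have eY x : s x = minn (m + 1) n.+1 :> nat -> x = Y.
  move=> h; apply: (@perm_inj _ s); rewrite permKV; apply: ord_inj; rewrite inordK //.
  by rewrite ltnS geq_minr.
apply: (@leq_trans #|[set X; Y]|); last by rewrite cards2; case: eqP.
apply/subset_leq_card/fintype.subsetP => x; rewrite !inE /marked_arc permM val_c.
have -> : arc m (s * c)%g x = arc m s x.
  apply/ffunP => p; rewrite !ffunE; case: ifP => // _.
  have cX : (c ^+ p)%g (c (s x)) = c ((c ^+ p)%g (s x)).
    by rewrite -[LHS]permM -[RHS]permM -expgS expgSr.
  by rewrite invMg !permM cX permK.
have := ltn_ord (s x); case: (eqVneq (s x : nat) 1) => [/eX ->|s1]; first by rewrite eqxx.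
case: (eqVneq (s x : nat) (minn (m + 1) n.+1)) => [/eY ->|sm]; first by rewrite eqxx orbT.
move=> sN; case: (eqVneq (s x).+1 N) => [e|ne].
  by rewrite e modnn; case: ifP => //; move: sm; lia.
rewrite modn_small; last by lia.
by case: ifP; case: ifP; rewrite ?eqxx //; move: sm s1; lia.
Qed.

Lemma hamming_marked_arc_t m s :
  hamming (marked_arc m (s * t)%g) (marked_arc m s) = 0.
Proof.
have tid (x : 'I_N) : 2 <= x -> t x = x.
  by move=> x2; apply: ord_inj; rewrite val_t; do 2 (case: eqP; first by lia).
apply: hamming_eq0 => x; rewrite /marked_arc permM.
have [x2|x2] := leqP 2 (s x); last first.
  suff -> : (2 <= t (s x)) = false by [].
  by rewrite val_t; case: eqP => // _; case: eqP => // _; lia.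
rewrite tid // x2 /=; case: ifP => // sxm; congr Some; apply/ffunP => p.
rewrite !ffunE; case: ifP => // pm; rewrite permM tid // invMg permM.
have cx : (c ^+ p)%g (s x) = s x + p :> nat by rewrite val_cX modn_small //; lia.
by congr (fun_of_perm _ _); apply: (@perm_inj _ t); rewrite permKV tid //; lia.
Qed.

(** The factor [N] balances the two terms: a generator changes at most 2 marks but up to [6 * N]
    orientations. *)
Definition kernel m s u : nat :=
  N * hamming (marked_arc m s) (marked_arc m u) +
  hamming (orientation s) (orientation u).

Lemma kernel_sym m s u : kernel m s u = kernel m u s.
Proof. by rewrite /kernel hamming_sym [hamming (orientation _) _]hamming_sym. Qed.

Lemma kernel_trans m u s v : kernel m s v <= kernel m s u + kernel m u v.
Proof.
rewrite /kernel addnACA -mulnDr leq_add ?hamming_trans //.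
by rewrite leq_mul2l hamming_trans orbT.
Qed.

Lemma kernel_cayley m s u : cay s u -> kernel m s u <= 8 * N.
Proof.
have kc v : kernel m (v * c)%g v <= 8 * N.
  rewrite /kernel (hamming_eq0 (orientation_c v)) addn0.
  by have := hamming_marked_arc_c m v; nia.
have kt v : kernel m (v * t)%g v <= 8 * N.
  by rewrite /kernel hamming_marked_arc_t; have := hamming_orientation_t v; lia.
by case/cayley_tcE => ->; rewrite ?kc // kernel_sym.
Qed.

Lemma kernel_within m s u k : within cay s u k -> kernel m s u <= 8 * N * k.
Proof.
case=> p [+ <-]; elim: p s k => [|v p IH] s k /=.
  by rewrite /kernel !hamming_eq0 // muln0.
case/andP=> sv pv; case: k => // k pk; apply: leq_trans (kernel_trans m v _ _) _.
by rewrite mulnS leq_add ?kernel_cayley // IH.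
Qed.


(** * Short walks from a small kernel *)

Lemma within_window w s u : w <= N ->
  (forall x, w <= u x -> s x = u x) ->
  within cay s u (w + (w + 3 * #|inversions s u|)).
Proof.
by move=> wN ag; apply: within_trans (sort_window wN ag); exact: within_cV.
Qed.

Lemma within_shift k j b s u :
  within cay (s * c ^+ k)%g (u * c ^+ j)%g b -> within cay s u (k + b + j).
Proof.
move=> h; apply: within_trans (within_trans (within_c s k) h) _.
by apply: (within_sym cayley_tc_sym); exact: within_c.
Qed.

Lemma hamming_orientation_slices s u :
  hamming (orientation s) (orientation u) =
  \sum_j #|[set p | cyc (s j) (s p.1) (s p.2) != cyc (u j) (u p.1) (u p.2)]|.
Proof.
rewrite /hamming -sum1_card.
under [RHS]eq_bigr do rewrite -sum1_card.
rewrite pair_big_dep /=.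
rewrite (reindex (fun q : 'I_N * ('I_N * 'I_N) => ((q.1, q.2.1), q.2.2))) /=; last first.
  by exists (fun q : 'I_N * 'I_N * 'I_N => (q.1.1, (q.1.2, q.2)));
    [case=> j [a b] | case=> [[j a] b]].
by apply: eq_bigl => -[j [a b]]; rewrite !inE.
Qed.

Lemma within_kernel_small m s u : N <= 4 * m ->
  kernel m s u < N * m -> within cay s u (19 * m).
Proof.
move=> Nm km.
(* Fewer than [N * m] triples disagree, so some first label [j] accounts for fewer than [m] of
   them. *)
have [j jm] : exists j, #|[set p | cyc (s j) (s p.1) (s p.2) !=
    cyc (u j) (u p.1) (u p.2)]| < m.
  apply/existsP; apply: contraLR km; rewrite negb_exists -leqNgt => /forallP h.
  rewrite /kernel hamming_orientation_slices; apply: leq_trans (leq_addl _ _).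
  rewrite -[X in X * m](card_ord N) -sum_nat_const; apply: leq_sum => i _.
  by rewrite leqNgt h.
have h0 v : (v * c ^+ (N - v j))%g j = 0 :> nat.
  by rewrite permM val_cX subnKC ?modnn // ltnW.
pose s1 := (s * c ^+ (N - s j))%g; pose u1 := (u * c ^+ (N - u j))%g.
(* Once [j] stands at position 0 in both arrangements, the cyclic order read from [j] is the linear
   order of positions, and inversions are disagreements. *)
have inv : #|inversions s1 u1| < m.
  apply: leq_ltn_trans jm; apply/subset_leq_card/fintype.subsetP => -[a b].
  rewrite !inE /= => /andP[sab uba].
  have := orientation_cX s (N - s j) (j, a, b).
  have := orientation_cX u (N - u j) (j, a, b).
  rewrite /orientation /= -/s1 -/u1 => <- <-.
  have [-> ->] : s1 j = 0 :> nat /\ u1 j = 0 :> nat by split; exact: h0.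
  by rewrite /cyc; lia.
have h : within cay s1 u1 (N + (N + 3 * #|inversions s1 u1|)).
  by apply: within_window => // x; rewrite leqNgt ltn_ord.
(* Two rotations and two passes of the head cost at most [4 * N <= 16 * m]; the swaps cost at most
   [3 * m]. *)
by apply: (within_le (@within_shift (N - s j) (N - u j) _ s u h)); lia.
Qed.

Lemma card_window s a b : b <= N -> #|[set x | a <= s x < b]| = b - a.
Proof.
move=> bN; have inj : injective (fun i : 'I_(b - a) => (s^-1)%g (inord (i + a))).
  move=> i k /perm_inj /(congr1 val); rewrite /= !inordK; last 2 first.
  - by have := ltn_ord k; lia.
  - by have := ltn_ord i; lia.
  by move/addIn/ord_inj.
rewrite -[RHS]card_ord -(card_imset _ inj); apply: eq_card => x; rewrite inE.
apply/idP/imsetP => [/andP[ax xb]|[i _ ->]].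
  have im : s x - a < b - a by lia.
  exists (Ordinal im) => //; apply: (@perm_inj _ s); rewrite permKV.
  by apply: ord_inj; rewrite inordK /= subnK.
by rewrite permKV inordK; have := ltn_ord i; lia.
Qed.

Lemma within_kernel_large m s u : 0 < m -> 4 * m < N ->
  kernel m s u < N * m -> within cay s u (12 * m).
Proof.
move=> m0 Nm km.
(* The arc term of the kernel is below [N * m], so fewer than [m] marks differ, while the window
   holds [m] labels. *)
have [x [xm ax]] : exists x, 2 <= s x < m + 2 /\ marked_arc m s x = marked_arc m u x.
  have cW : #|[set x | 2 <= s x < m + 2]| = m by rewrite card_window; lia.
  have : 0 < #|[set x | 2 <= s x < m + 2] :\: [set x | marked_arc m s x != marked_arc m u x]|.
    rewrite cardsD subn_gt0 cW.
    apply: leq_ltn_trans (subset_leq_card (subsetIr _ _)) _.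
    rewrite -[#|_|]/(hamming (marked_arc m s) (marked_arc m u)).
    by move: km; rewrite /kernel; nia.
  by case/card_gt0P => x; rewrite !inE negbK => /andP[/eqP ax xm]; exists x.
have um : 2 <= u x < m + 2 by move: ax; rewrite /marked_arc xm; case: ifP.
have {ax} ax : arc m s x = arc m u x.
  by move: ax; rewrite /marked_arc xm um => -[].
(* After these rotations [x] stands at position [m + 1], and the common arc fills exactly the
   positions from there to the last. *)
pose s1 := (s * c ^+ (m + 1 - s x))%g; pose u1 := (u * c ^+ (m + 1 - u x))%g.
have arcE v (p : 'I_N) : 2 <= v x < m + 2 -> m + 1 + p < N ->
    (v * c ^+ (m + 1 - v x))%g (arc m v x p) = m + 1 + p :> nat.
  move=> vm pm; rewrite permM ffunE pm permKV -permM -expgD val_cX modn_small; lia.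
have ag y : m + 1 <= u1 y -> s1 y = u1 y.
  move=> uy; have pN : u1 y - (m + 1) < N by have := ltn_ord (u1 y); lia.
  have pm : m + 1 + Ordinal pN < N by rewrite /= subnKC.
  have ey : y = arc m u x (Ordinal pN).
    apply: (@perm_inj _ u1); apply: ord_inj.
    by rewrite [RHS]arcE //= subnKC.
  apply: ord_inj; rewrite [in LHS]ey -ax [LHS]arcE //= subnKC //.
(* Both labels of an inversion lie below position [m + 1]. Seen from any label [j] of the common arc
   their cyclic order is their linear order, so every such [j] detects the inversion. *)
have inv : (N - (m + 1)) * #|inversions s1 u1| <= hamming (orientation s) (orientation u).
  rewrite hamming_orientation_slices.
  have -> : N - (m + 1) = #|[set j | m + 1 <= u1 j]|.
    rewrite -(@card_window u1) //; apply: eq_card => y.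
    by rewrite !inE ltn_ord andbT.
  rewrite -sum_nat_const [leqRHS](bigID (mem [set j | m + 1 <= u1 j])) /=.
  apply: leq_trans (leq_addr _ _); apply: leq_sum => j; rewrite inE => uj.
  apply/subset_leq_card/fintype.subsetP => -[a b].
  rewrite !inE /= => /andP[sab uba].
  have := orientation_cX s (m + 1 - s x) (j, a, b).
  have := orientation_cX u (m + 1 - u x) (j, a, b).
  rewrite /orientation /= -/s1 -/u1 => <- <-; rewrite (ag _ uj).
  have nu y : s1 y < m + 1 \/ s1 y = u1 y :> nat.
    by have [|/(agree_above ag) ->] := ltnP (s1 y) (m + 1); [left|right].
  have nu' y : u1 y < m + 1 \/ s1 y = u1 y :> nat.
    by have [|/ag ->] := ltnP (u1 y) (m + 1); [left|right].
  move: (nu a) (nu b) (nu' a) (nu' b); rewrite /cyc; lia.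
have /within_window/(_ ag) h : m + 1 <= N by lia.
apply: (within_le (@within_shift (m + 1 - s x) (m + 1 - u x) _ s u h)).
(* As [4 * m < N] and [m > 0], the common arc contains at least half of the labels. *)
have inv2 : #|inversions s1 u1| < 2 * m by move: km; rewrite /kernel; nia.
lia.
Qed.

Lemma graph_dist_kernel m s u : 0 < m -> kernel m s u < N * m ->
  graph_dist cay s u <= 19 * m.
Proof.
move=> m0 km; apply: graph_dist_le; have [Nm|Nm] := leqP N (4 * m).
  exact: within_kernel_small.
by apply: within_le (within_kernel_large m0 Nm km) _; lia.
Qed.

Lemma connected_cayley_tc : connected_graph cay.
Proof.
move=> s u; have [p [ps <- _]] : within cay s u (N + (N + 3 * #|inversions s u|)).
  by apply: within_window => // x; rewrite leqNgt ltn_ord.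
by apply/connectP; exists p.
Qed.

Lemma kernel_graph_dist m s u : kernel m s u <= 8 * N * graph_dist cay s u.
Proof. exact/kernel_within/graph_distP/connected_cayley_tc. Qed.

End CayleySym.
(** * Spectral gap and Poincare inequality *)

Lemma char_poly_similar (F : fieldType) n (Q A B : 'M[F]_n) :
  Q \in unitmx -> Q *m A = B *m Q -> char_poly A = char_poly B.
Proof.
move=> Qu QA.
have : map_mx polyC Q *m char_poly_mx A = char_poly_mx B *m map_mx polyC Q.
  by rewrite /char_poly_mx mulmxBr mulmxBl -!map_mxM QA scalar_mxC.
move/(congr1 determinant); rewrite !det_mulmx mulrC => /mulIf; apply.
by rewrite det_map_mx polyC_eq0 -unitfE -unitmxE.
Qed.

(** * Eigenbasis of a reversible random walk *)

Section SpectralBasis.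
Local Open Scope sesquilinear_scope.
Variables (C : numClosedFieldType) (T : finType) (a : T -> T -> C) (d : T -> C).
Hypothesis a_sym : forall u v, a u v = a v u.
Hypothesis a_real : forall u v, (a u v)^* = a u v.
Hypothesis d_gt0 : forall u, 0 < d u.

(** The transition matrix is similar, through the diagonal matrix of square roots of [d], to the
    Hermitian matrix with entries [a u v] divided by [w u * w v]. The rows of a unitary matrix
    diagonalizing the latter, divided by [w], are orthonormal for the weight [d]. *)
Lemma spectral_basis :
  exists (X : 'I_#|T| -> C) (h : 'I_#|T| -> T -> C),
  [/\ forall i j, \sum_u d u * h i u * (h j u)^* = (i == j)%:R,
      forall i u, \sum_v a u v * h i v = X i * d u * h i u,
      forall u v, \sum_i (h i u)^* * h i v = (u == v)%:R / d u &
      char_poly (\matrix_(i < #|T|, j < #|T|)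
                   (a (enum_val i) (enum_val j) / d (enum_val i)))
        = \prod_(x <- map X (enum 'I_#|T|)) ('X - x%:P)].
Proof.
set M := (X in char_poly X).
pose w u := sqrtC (d u).
have w_gt0 u : 0 < w u by rewrite sqrtC_gt0.
have w0 u : w u != 0 by rewrite gt_eqF.
have w2 u : w u * w u = d u by rewrite -expr2 sqrtCK.
have wC u : (w u)^* = w u by apply/CrealP/ger0_real/ltW.
pose S : 'M[C]_#|T| := \matrix_(i, j)
  (a (enum_val i) (enum_val j) / (w (enum_val i) * w (enum_val j))).
have S_normal : S \is normalmx.
  apply/normalmxP; suff -> : S ^t* = S by [].
  apply/matrixP => i j; rewrite !mxE rmorphM fmorphV rmorphM /= !wC a_real a_sym.
  by rewrite [w _ * _]mulrC.
have := orthomx_spectralP S_normal; set Q := spectralmx S; set D := spectral_diag S.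
move=> SE; have Qu : Q \in unitmx by exact: spectral_unit.
have QS : Q *m S = diag_mx D *m Q by rewrite SE !mulmxA mulmxV // mul1mx.
have QQ : Q *m Q ^t* = 1%:M by apply/unitarymxP/spectral_unitarymx.
have QQ' : Q ^t* *m Q = 1%:M by rewrite -invmx_unitary ?spectral_unitarymx // mulVmx.
exists (fun i => D 0 i), (fun i u => Q i (enum_rank u) / w u); split.
- move=> i j; have /matrixP/(_ i j) := QQ; rewrite !mxE => <-.
  rewrite (reindex_onto enum_rank enum_val) /=; last by move=> k _; rewrite enum_valK.
  apply: eq_big => [u|u _]; first by rewrite enum_rankK eqxx.
  by rewrite !mxE rmorphM fmorphV /= wC -w2; field; rewrite w0.
- move=> i u; have /matrixP/(_ i (enum_rank u)) := QS.
  rewrite mul_diag_mx !mxE => h.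
  have -> : D 0 i * d u * (Q i (enum_rank u) / w u) =
      w u * (D 0 i * Q i (enum_rank u)).
    by rewrite -w2; field; rewrite w0.
  rewrite -h mulr_sumr (reindex_onto enum_val enum_rank) /=; last first.
    by move=> k _; rewrite enum_rankK.
  apply: eq_big => [k|k _]; first by rewrite enum_valK eqxx.
  rewrite !mxE enum_valK enum_rankK a_sym; field.
  by rewrite !w0.
- move=> u v; have /matrixP/(_ (enum_rank u) (enum_rank v)) := QQ'.
  rewrite !mxE (inj_eq enum_rank_inj) => h.
  have -> : (u == v)%:R / d u = (u == v)%:R / (w u * w v).
    by case: eqP => [<-|]; rewrite ?w2 ?mul0r.
  rewrite -h mulr_suml; apply: eq_bigr => i _.
  by rewrite !mxE rmorphM fmorphV /= wC; field; rewrite !w0.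
- rewrite big_map big_enum /=.
  have -> : \prod_(i in 'I_#|T|) ('X - (D 0 i)%:P) = char_poly (diag_mx D).
    rewrite char_poly_trig ?diag_mx_is_trig //.
    by apply: eq_bigr => i _; rewrite mxE eqxx.
  rewrite -(char_poly_similar Qu QS).
  apply: (@char_poly_similar _ _ (diag_mx (\row_i w (enum_val i)))).
    rewrite unitmxE det_diag unitfE; apply/prodf_neq0 => i _.
    by rewrite mxE.
  apply/matrixP => i j; rewrite mul_diag_mx mul_mx_diag !mxE -w2; field.
  by rewrite !w0.
Qed.

End SpectralBasis.
Section Dirichlet.
Variables (C : numClosedFieldType) (T : finType) (a : T -> T -> C).
Hypothesis a_sym : forall u v, a u v = a v u.
Let d u := \sum_v a u v.
Variables (x : C) (h : T -> C).
Hypothesis h_norm : \sum_u d u * h u * (h u)^* = 1.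
Hypothesis h_eigen : forall u, \sum_v a u v * h v = x * d u * h u.

(** Expanding the square gives two diagonal sums equal to 1 and two cross sums equal to [x].
    Nonnegativity for the two signs bounds [x] between -1 and 1, and the case [x = 1] forces [h] to
    be constant along edges. *)
Lemma dirichlet_form (s : bool) :
  \sum_u \sum_v a u v * `|h u - (-1) ^+ s * h v| ^+ 2 = 2 * (1 - (-1) ^+ s * x).
Proof.
set sg := (-1) ^+ s; have sgC : sg^* = sg by rewrite rmorphXn rmorphN1.
have sg2 : sg * sg = 1 by rewrite -expr2 sqrr_sign.
have E1 : \sum_u \sum_v a u v * (h u * (h u)^*) = 1.
  by rewrite -h_norm; apply: eq_bigr => u _; rewrite -mulr_suml mulrA.
have E2 : \sum_u \sum_v a u v * (h v * (h v)^*) = 1.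
  rewrite exchange_big /= -h_norm; apply: eq_bigr => u _.
  by rewrite -mulr_suml mulrA; under eq_bigr do rewrite a_sym.
have E3 : \sum_u \sum_v a u v * (h v * (h u)^*) = x.
  rewrite -[RHS]mulr1 -h_norm mulr_sumr; apply: eq_bigr => u _.
  under eq_bigr do rewrite mulrA.
  by rewrite -mulr_suml h_eigen !mulrA.
have E4 : \sum_u \sum_v a u v * (h u * (h v)^*) = x.
  rewrite exchange_big /= -[RHS]E3; apply: eq_bigr => u _; apply: eq_bigr => v _.
  by rewrite a_sym.
transitivity (\sum_u \sum_v a u v * (h u * (h u)^*) +
  \sum_u \sum_v a u v * (h v * (h v)^*) - sg * (\sum_u \sum_v a u v * (h v * (h u)^*)) -
  sg * (\sum_u \sum_v a u v * (h u * (h v)^*))); last first.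
  by rewrite E1 E2 E3 E4; ring.
rewrite !mulr_sumr -!sumrN -!big_split /=; apply: eq_bigr => u _.
rewrite !mulr_sumr -!sumrN -!big_split /=; apply: eq_bigr => v _.
rewrite normCK rmorphB rmorphM /= sgC.
rewrite -[X in _ + X - _ - _]mul1r -sg2; ring.
Qed.

End Dirichlet.

(** * The second eigenvalue as a Rayleigh bound *)

Section SpectralGap.
Variables (R : realType) (T : finType) (e : rel T).
Hypotheses (e_simple : simple_graph e) (e_conn : connected_graph e).

Lemma degreeE (S : pzSemiRingType) u : (degree e u)%:R = \sum_v (e u v)%:R :> S.
Proof.
rewrite -[RHS]/(\sum_v ((e u v : nat)%:R)) -natr_sum; congr _%:R.
rewrite /degree -sum1_card big_mkcond; apply: eq_bigr => v _.
by have -> : (v \in in_set [set y | e u y]%classic) = e u v;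
  [apply/idP/idP; rewrite in_setE | case: (e u v)].
Qed.

Hypothesis T_gt1 : (1 < #|T|)%N.

Lemma degree_gt0 u : (0 < degree e u)%N.
Proof.
have [v uv] : exists v, u != v.
  case/card_gt1P: T_gt1 => x [y [_ _ xy]].
  by case: (eqVneq u x) => [->|]; [exists y | exists x].
have /connectP[[|z p] /= + ev] := e_conn u v; first by rewrite ev eqxx in uv.
case/andP=> uz _; rewrite -(ltr0n int) (@degreeE int) (bigD1 z) //= uz.
by apply: ltr_pwDl => //; exact: sumr_ge0.
Qed.


(* The eigenbasis lives over the complex numbers; [iota] embeds the reals. *)
Variables (C : numClosedFieldType) (iota : {rmorphism R -> C}).
Hypothesis iota_le : {mono iota : x y / x <= y}.

(** By connectedness the eigenfunctions for 1 are constant, so 1 is a simple eigenvalue and heads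
    the sorted list; all others are at most [lam]. A function of mean zero has no component along
    constants, and expanding it in the eigenbasis gives the inequality. *)
Lemma second_eigenvalue_bounds lam :
  second_largest_eigenvalue (transition_matrix R e) lam ->
  [/\ lam < 1, -1 <= lam &
    forall x : T -> R, \sum_u (degree e u)%:R * x u = 0 ->
      \sum_u \sum_v (e u v)%:R * (x u * x v) <=
        lam * \sum_u (degree e u)%:R * x u ^+ 2].
Proof.
case=> s [charE s_sorted s_gt1 lamE].
pose a u v : C := (e u v)%:R; pose d u : C := (degree e u)%:R.
have dE u : d u = \sum_v a u v by exact: degreeE.
have a_sym u v : a u v = a v u by rewrite /a e_simple.1.
have a_real u v : (a u v)^* = a u v by exact: rmorph_nat.
have d_gt0 u : 0 < d u by rewrite ltr0n degree_gt0.
have [X [h [h_norm h_eigen h_complete XE]]] := spectral_basis a_sym a_real d_gt0.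
have D (b : bool) i : \sum_u \sum_v a u v * `|h i u - (-1) ^+ b * h i v| ^+ 2 =
    2 * (1 - (-1) ^+ b * X i).
  apply: (dirichlet_form a_sym).
    transitivity ((i == i)%:R : C); last by rewrite eqxx.
    by rewrite -h_norm; apply: eq_bigr => u _; rewrite dE.
  by move=> u; rewrite h_eigen dE.
have D_ge0 (b : bool) i : 0 <= 1 - (-1) ^+ b * X i.
  rewrite -(pmulr_rge0 _ (ltr0n C 2)) -D.
  by do 2 (apply: sumr_ge0 => ? _); rewrite mulr_ge0 ?ler0n ?exprn_ge0.
have X_le1 i : X i <= 1 by have := D_ge0 false i; rewrite mul1r subr_ge0.
have X_geN1 i : - 1 <= X i.
  by rewrite -subr_ge0 opprK addrC; have := D_ge0 true i; rewrite /= expr1 mulN1r !opprK.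
have h_const i u v : X i = 1 -> h i u = h i v.
  move=> Xi; have := D false i; rewrite Xi mulr1 subrr mulr0 => /eqP D0.
  have edge u1 v1 : e u1 v1 -> h i u1 = h i v1.
    move=> e1; move: D0; rewrite psumr_eq0; last first.
      by move=> ? _; apply: sumr_ge0 => ? _; rewrite mulr_ge0 ?ler0n ?exprn_ge0.
    move=> /allP/(_ u1); rewrite mem_index_enum => /(_ isT) /=.
    rewrite psumr_eq0; last by move=> ? _; rewrite mulr_ge0 ?ler0n ?exprn_ge0.
    move=> /allP/(_ v1); rewrite mem_index_enum => /(_ isT) /=.
    by rewrite /a e1 !mul1r expf_eq0 /= normr_eq0 subr_eq0 => /eqP.
  case/connectP: (e_conn u v) => p + ->.
  by elim: p u => //= z p IH u /andP[/edge -> /IH].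
have [u0] : exists u : T, true by case/card_gt0P: (ltnW T_gt1) => u; exists u.
move=> _; have V0 : \sum_u d u != 0.
  by rewrite gt_eqF // (bigD1 u0) //= ltr_pwDl // sumr_ge0 // => u _; exact: ltW.
have h_norm_const i j : X i = 1 -> X j = 1 ->
    (\sum_u d u) * (h i u0 * (h j u0)^*) = (i == j)%:R.
  move=> Xi Xj; rewrite -h_norm mulr_suml; apply: eq_bigr => u _.
  by rewrite mulrA (h_const i u u0) // (h_const j u u0).
have X_inj i j : X i = 1 -> X j = 1 -> i = j.
  (* Two nonzero constant functions cannot be orthogonal. *)
  move=> Xi Xj; apply/eqP/negPn/negP => /negPf ij; have /eqP := h_norm_const i j Xi Xj.
  rewrite ij !mulf_eq0 (negPf V0) conjC_eq0 /= => /orP[] /eqP h0.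
    by have /eqP := h_norm_const i i Xi Xi; rewrite eqxx h0 mul0r mulr0 eq_sym oner_eq0.
  by have /eqP := h_norm_const j j Xj Xj; rewrite eqxx h0 mul0r mulr0 eq_sym oner_eq0.
have orth i : X i != 1 -> \sum_u d u * h i u = 0.
  move=> Xi; suff : (1 - X i) * \sum_u d u * h i u = 0.
    by move/eqP; rewrite mulf_eq0 subr_eq0 eq_sym (negPf Xi) => /eqP.
  rewrite mulrBl mul1r mulr_sumr; apply/eqP; rewrite subr_eq0; apply/eqP.
  under [RHS]eq_bigr do rewrite mulrA -h_eigen.
  rewrite exchange_big /=; apply: eq_bigr => v _; rewrite dE -mulr_suml.
  by congr (_ * _); apply: eq_bigr => u _.
(* Otherwise every [h i] has mean zero; by completeness the constant 1, expanded in the basis and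
   evaluated at [u0], would be 0. *)
have [i0 X0] : exists i, X i = 1.
  apply: contrapT => /forallNP noX; suff : (0 : C) = 1.
    by move/eqP; rewrite eq_sym oner_eq0.
  transitivity (\sum_v d v * \sum_i (h i u0)^* * h i v).
    under eq_bigr do rewrite mulr_sumr.
    rewrite exchange_big /= big1 // => i _.
    under eq_bigr do rewrite mulrCA.
    by rewrite -mulr_sumr orth ?mulr0 //; apply/eqP.
  rewrite (bigD1 u0) //= [X in _ + X]big1 => [|v /negPf vu]; last first.
    by rewrite h_complete eq_sym vu mul0r mulr0.
  by rewrite h_complete eqxx addr0 mul1r mulfV // gt_eqF.
(* Unique factorization of the characteristic polynomial identifies the complex eigenvalues with the
   given real list, multiplicities included. *)
have perm : perm_eq (map X (enum 'I_#|T|)) (map iota s).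
  apply: prod_XsubC_eq; rewrite -XE.
  rewrite big_map -map_prod_XsubC -charE map_char_poly; congr char_poly.
  by apply/matrixP => i j; rewrite !mxE fmorph_div !rmorph_nat.
have iota_inj : injective iota by exact: fmorph_inj.
have s_X y : y \in s -> exists i, X i = iota y.
  move=> ys; have : iota y \in map iota s by exact: map_f.
  by rewrite -(perm_mem perm) => /mapP[i _ ->]; exists i.
have X_s i : exists2 y, y \in s & X i = iota y.
  have : X i \in map iota s by rewrite -(perm_mem perm) map_f // mem_enum.
  by case/mapP => y ys ->; exists y.
have count1 : (count_mem 1%R s <= 1)%N.
  have -> : count_mem 1 s = count_mem 1 (map iota s).
    rewrite count_map; apply: eq_count => y /=.
    by rewrite -(inj_eq iota_inj) rmorph1.
  rewrite -(seq.permP perm) count_map.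
  have cE (I : finType) (p : pred I) : count p (enum I) = #|p|.
    by rewrite cardE size_filter enumT.
  rewrite cE.
  apply/card_le1_eqP => i j; rewrite !inE => /eqP Xi /eqP Xj; exact: X_inj.
have s_le1 y : y \in s -> y <= 1.
  by case/s_X => i Xi; rewrite -iota_le rmorph1 -Xi.
case: s s_gt1 s_sorted lamE charE perm s_X X_s count1 s_le1 => [//|x0 [//|x1 s]] _.
rewrite /= => /andP[x10 s_path] -> _ _ s_X X_s count1 s_le1.
have max_s y : y \in s -> y <= x1.
  by move=> ys; have := order_path_min ge_trans s_path => /allP/(_ y ys).
have x0E : x0 = 1.
  apply/eqP; rewrite eq_le s_le1 ?mem_head //=.
  have [y + ] := X_s i0; rewrite X0 -(rmorph1 iota) => ys /iota_inj y1.
  move: ys; rewrite -y1.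
  rewrite !inE => /or3P[/eqP <- //|/eqP -> //|/max_s h1].
  exact: le_trans h1 x10.
have x1_neq1 : x1 != 1.
  by apply/eqP => x1E; move: count1; rewrite x0E x1E eqxx.
have x1_in : x1 \in [:: x0, x1 & s] by rewrite !inE eqxx orbT.
split.
- by rewrite lt_neqAle x1_neq1 s_le1.
- by have [i Xi] := s_X x1 x1_in; rewrite -iota_le rmorphN1 -Xi.
move=> x x_mean.
have X_le i : X i != 1 -> X i <= iota x1.
  have [y + ->] := X_s i; rewrite -(rmorph1 iota) (inj_eq iota_inj) iota_le.
  rewrite !inE -x0E => /or3P[/eqP ->|/eqP -> //|/max_s //].
  by rewrite eqxx.
pose y u := iota (x u); have yC u : (y u)^* = y u.
  by apply/CrealP; rewrite realE -(rmorph0 iota) !iota_le -realE num_real.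
have dC u : (d u)^* = d u by exact: rmorph_nat.
(* The coefficients of [x] in the eigenbasis; both quadratic forms become diagonal in them. *)
pose Z i := \sum_u d u * y u * (h i u)^*.
have ZC i : (Z i)^* = \sum_u d u * y u * h i u.
  by rewrite rmorph_sum; apply: eq_bigr => u _; rewrite !rmorphM /= conjCK dC yC.
have yE v : y v = \sum_i Z i * h i v.
  transitivity (\sum_u d u * y u * \sum_i (h i u)^* * h i v).
    rewrite (bigD1 v) //= [X in _ + X]big1 => [|u /negPf uv]; last first.
      by rewrite h_complete uv mul0r mulr0.
    by rewrite h_complete eqxx addr0 mul1r mulrAC mulfV ?mul1r // gt_eqF.
  under eq_bigr do rewrite mulr_sumr.
  rewrite exchange_big /=; apply: eq_bigr => i _; rewrite mulr_suml.
  by apply: eq_bigr => u _; rewrite mulrA.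
rewrite -iota_le rmorphM !rmorph_sum /=.
have -> : \sum_i iota (\sum_v (e i v)%:R * (x i * x v)) = \sum_i X i * (Z i * (Z i)^*).
  transitivity (\sum_u y u * \sum_v a u v * \sum_i Z i * h i v).
    apply: eq_bigr => u _; rewrite rmorph_sum mulr_sumr; apply: eq_bigr => v _.
    by rewrite -yE !rmorphM rmorph_nat /= mulrCA.
  under eq_bigr do under eq_bigr do rewrite mulr_sumr.
  under eq_bigr do rewrite exchange_big mulr_sumr /=.
  rewrite exchange_big /=; apply: eq_bigr => i _; rewrite ZC !mulr_sumr.
  apply: eq_bigr => u _.
  transitivity (y u * (Z i * \sum_v a u v * h i v)).
    by congr (_ * _); rewrite mulr_sumr; apply: eq_bigr => v _; rewrite mulrCA.
  by rewrite h_eigen; ring.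
have -> : \sum_i iota ((degree e i)%:R * x i ^+ 2) = \sum_i Z i * (Z i)^*.
  transitivity (\sum_u d u * y u * \sum_i Z i * h i u).
    by apply: eq_bigr => u _; rewrite -yE rmorphM rmorphXn rmorph_nat /= -mulrA.
  under eq_bigr do rewrite mulr_sumr.
  rewrite exchange_big /=; apply: eq_bigr => i _; rewrite ZC mulr_sumr.
  by apply: eq_bigr => u _; ring.
rewrite mulr_sumr; apply: ler_sum => i _.
have [Xi|/X_le Xi] := eqVneq (X i) 1; last by rewrite ler_wpM2r // mul_conjC_ge0.
suff -> : Z i = 0 by rewrite mul0r !mulr0.
transitivity ((h i u0)^* * iota (\sum_u (degree e u)%:R * x u)).
  rewrite rmorph_sum mulr_sumr; apply: eq_bigr => u _.
  by rewrite rmorphM rmorph_nat (h_const i u u0 Xi) mulrC.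
by rewrite x_mean rmorph0 mulr0.
Qed.

End SpectralGap.

(** * Poincare inequalities for real and finite-valued functions *)

Section Poincare.
Variables (R : realType) (T : finType) (e : rel T) (lam : R).
Hypotheses (e_simple : simple_graph e) (e_conn : connected_graph e).
Hypothesis T_gt1 : (1 < #|T|)%N.
Hypothesis lam_eig : second_largest_eigenvalue (transition_matrix R e) lam.
Local Notation d u := ((degree e u)%:R : R).
Local Notation vol := (\sum_u d u).

Let eig_bounds :=
  second_eigenvalue_bounds e_simple e_conn T_gt1 (@lecR R) lam_eig.

Lemma second_eigenvalue_lt1 : lam < 1.
Proof. by case: eig_bounds. Qed.

Lemma second_eigenvalue_geN1 : -1 <= lam.
Proof. by case: eig_bounds. Qed.

Lemma vol_gt0 : 0 < vol.
Proof.
have [u _] := card_gt0P (ltnW T_gt1).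
rewrite (bigD1 u) //= ltr_pwDl ?ltr0n ?degree_gt0 // sumr_ge0 //.
Qed.

(** Both sides depend only on differences of [g], so [g] may be centred at its stationary mean [m],
    which makes the eigenvalue bound applicable. *)
Lemma poincare (g : T -> R) :
  (1 - lam) * \sum_u \sum_v d u * d v * (g u - g v) ^+ 2 <=
  vol * \sum_u \sum_v (e u v)%:R * (g u - g v) ^+ 2.
Proof.
pose m := (\sum_u d u * g u) / vol; pose x u := g u - m.
have x_mean : \sum_u d u * x u = 0.
  under eq_bigr do rewrite mulrBr.
  by rewrite sumrB -mulr_suml /m mulrC mulfVK ?subrr // gt_eqF // vol_gt0.
have gE u v : g u - g v = x u - x v by rewrite /x; ring.
under eq_bigr do under eq_bigr do rewrite gE.
under [X in _ <= _ * X]eq_bigr do under eq_bigr do rewrite gE.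
pose q := \sum_u d u * x u ^+ 2.
have -> : \sum_u \sum_v d u * d v * (x u - x v) ^+ 2 = 2 * vol * q.
  transitivity (\sum_u (d u * x u ^+ 2 * vol + d u * q -
      2 * (d u * x u) * \sum_v d v * x v)).
    apply: eq_bigr => u _; rewrite /q !mulr_sumr -sumrN -!big_split /=.
    by apply: eq_bigr => v _; ring.
  rewrite sumrB big_split /= -!mulr_suml x_mean mulr0 -/q; ring.
have -> : \sum_u \sum_v (e u v)%:R * (x u - x v) ^+ 2 =
    2 * (q - \sum_u \sum_v (e u v)%:R * (x u * x v)).
  have q1 : \sum_u \sum_v (e u v)%:R * x u ^+ 2 = q.
    by apply: eq_bigr => u _; rewrite -mulr_suml -degreeE.
  have q2 : \sum_u \sum_v (e u v)%:R * x v ^+ 2 = q.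
    rewrite exchange_big /= -q1; apply: eq_bigr => u _; apply: eq_bigr => v _.
    by rewrite e_simple.1.
  transitivity (q + q - 2 * \sum_u \sum_v (e u v)%:R * (x u * x v)); last by ring.
  rewrite -{1}q1 -q2.
  rewrite !mulr_sumr -sumrN -!big_split /=; apply: eq_bigr => u _.
  rewrite !mulr_sumr -sumrN -!big_split /=; apply: eq_bigr => v _.
  by ring.
have [_ _ /(_ x x_mean)] := eig_bounds; rewrite -/q => h.
have -> : (1 - lam) * (2 * vol * q) = vol * (2 * (q - lam * q)) by ring.
by rewrite ler_pM2l ?vol_gt0 // ler_pM2l // lerB.
Qed.

(** The real inequality is summed over the indicator functions of the values of [g]; a pair with
    different values is counted by exactly two of them, hence the factor 2 in [sumE]. *)
Lemma poincare_neq (F : finType) (g : T -> F) :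
  (1 - lam) * \sum_u \sum_v d u * d v * (g u != g v)%:R <=
  vol * \sum_u \sum_v (e u v)%:R * (g u != g v)%:R.
Proof.
have sumE (w : T -> T -> R) : (\sum_u \sum_v w u v * (g u != g v)%:R) * 2 =
    \sum_k \sum_u \sum_v w u v * ((g u == k)%:R - (g v == k)%:R) ^+ 2.
  rewrite mulr_suml; under eq_bigr do rewrite mulr_suml.
  rewrite [RHS]exchange_big; apply: eq_bigr => u _ /=.
  rewrite [RHS]exchange_big; apply: eq_bigr => v _ /=.
  rewrite -mulr_sumr -mulrA; congr (_ * _); have [<-|guv] := eqVneq (g u) (g v).
    by rewrite mul0r big1 // => k _; rewrite subrr expr0n.
  rewrite (bigD1 (g u)) //= (bigD1 (g v)) 1?eq_sym //= [X in _ + (_ + X)]big1.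
    by rewrite !eqxx (negPf guv) /=; ring.
  move=> k /andP[ku kv].
  by rewrite eq_sym (negPf ku) [g v == k]eq_sym (negPf kv) subrr expr0n.
rewrite -(ler_pM2r (ltr0n R 2)) -[leLHS]mulrA -[leRHS]mulrA !sumE.
rewrite [leLHS]mulr_sumr [leRHS]mulr_sumr; apply: ler_sum => k _.
exact: poincare.
Qed.

Lemma poincare_hamming (I F : finType) (g : T -> I -> F) :
  (1 - lam) * \sum_u \sum_v d u * d v * (hamming (g u) (g v))%:R <=
  vol * \sum_u \sum_v (e u v)%:R * (hamming (g u) (g v))%:R.
Proof.
have sumE (w : T -> T -> R) : \sum_u \sum_v w u v * (hamming (g u) (g v))%:R =
    \sum_i \sum_u \sum_v w u v * (g u i != g v i)%:R.
  rewrite [RHS]exchange_big; apply: eq_bigr => u _ /=.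
  rewrite [RHS]exchange_big; apply: eq_bigr => v _ /=.
  rewrite -mulr_sumr; congr (_ * _); rewrite /hamming -sum1_card big_mkcond natr_sum.
  by apply: eq_bigr => i _; rewrite inE; case: ifP.
rewrite !sumE [leLHS]mulr_sumr [leRHS]mulr_sumr; apply: ler_sum => k _; exact: poincare_neq.
Qed.

End Poincare.

(** * Growth of balls *)

Section BallGrowth.
Local Open Scope nat_scope.
Variables (T : finType) (e : rel T).
Hypotheses (e_simple : simple_graph e) (e_conn : connected_graph e).
Local Notation dist := (graph_dist e).
Local Notation Delta := (max_degree e).

Lemma degree_sum u : degree e u = \sum_v e u v.
Proof.
by have := @degreeE T e int u; rewrite -natr_sum => /eqP; rewrite eqr_nat => /eqP.
Qed.

Lemma degree_le u : degree e u <= Delta.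
Proof. exact: leq_bigmax. Qed.

Lemma graph_dist_eq0 u v : dist u v = 0 -> u = v.
Proof.
by move=> d0; have [[|z p] []] := graph_distP (e_conn u v); rewrite d0.
Qed.

Definition sphere u r : {set T} := [set v | dist u v == r].
Definition ball u r : {set T} := [set v | dist u v <= r].

Lemma ballS u r : ball u r.+1 = ball u r :|: sphere u r.+1.
Proof. by apply/setP => v; rewrite !inE leq_eqVlt ltnS orbC. Qed.

Lemma ball0 u : ball u 0 = [set u].
Proof.
apply/setP => v; rewrite !inE leqn0; apply/eqP/eqP => [/graph_dist_eq0 -> //|->].
exact: graph_dist0.
Qed.

(** Edges between consecutive spheres are counted twice: every vertex of the outer sphere has a
    neighbour on the inner one. *)
Lemma card_sphereS u r b :
  (forall v, dist u v = r -> \sum_(w | dist u w == r.+1) e v w <= b) ->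
  #|sphere u r.+1| <= b * #|sphere u r|.
Proof.
move=> hb; apply: (@leq_trans (\sum_(w in sphere u r.+1) \sum_(v in sphere u r) e v w)).
  rewrite -sum1_card; apply: leq_sum => w; rewrite inE => /eqP dw.
  have [|z ez zw] := graph_dist_pred (e_conn u w).
    by apply/eqP => uw; rewrite -uw graph_dist0 in dw.
  have := graph_dist_edge (e_conn u z) ez; rewrite dw ltnS => rz.
  by rewrite (bigD1 z) ?ez // inE eqn_leq rz -ltnS -dw zw.
rewrite exchange_big /= mulnC -sum_nat_const; apply: leq_sum => v; rewrite inE => /eqP dv.
by under eq_bigl do rewrite inE; exact: hb.
Qed.

Lemma card_sphere1 u : #|sphere u 1| <= Delta.
Proof.
have := @card_sphereS u 0 Delta; have -> : sphere u 0 = [set u].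
  by rewrite -ball0; apply/setP => v; rewrite !inE leqn0.
rewrite cards1 muln1; apply => v _; apply: leq_trans (degree_le v).
by rewrite degree_sum [leqRHS](bigID (fun w => dist u w == 1)) leq_addr.
Qed.

(** At a vertex other than [u] one edge leads back towards [u], which leaves at most [Delta.-1]
    leading outwards. *)
Lemma card_sphereSS u r : #|sphere u r.+2| <= Delta.-1 * #|sphere u r.+1|.
Proof.
apply: card_sphereS => v dv.
have [|z ez zv] := graph_dist_pred (e_conn u v).
  by apply/eqP => uv; rewrite -uv graph_dist0 in dv.
have := degree_le v; rewrite degree_sum (bigD1 z) //= e_simple.1 ez => h.
rewrite -ltnS (ltn_predK (leq_trans (leq_addr _ _) h)); apply: leq_trans h.
rewrite add1n ltnS [leqRHS](bigID (fun w => dist u w == r.+2)) /=.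
apply: leq_trans (leq_addr _ _); rewrite leq_eqVlt; apply/orP; left; apply/eqP.
apply: eq_bigl => w; apply/eqP/andP => [dw|[_ /eqP //]].
by split; [apply/eqP => wz; move: zv; rewrite -wz dw dv; lia | rewrite dw].
Qed.

(** Bounding later spheres by [Delta.-1 * Delta ^ r.+1] makes the sum telescope; the extra 1 is the
    centre, since the first sphere may already have [Delta] vertices. *)
Lemma card_ball u r : #|ball u r| <= Delta ^ r + 1.
Proof.
elim: r => [|r IH]; first by rewrite ball0 cards1.
rewrite ballS; apply: leq_trans (leq_card_setU _ _) _.
case: r IH => [|r] IH.
  by rewrite ball0 cards1 addnC leq_add2r expn1 card_sphere1.
have [D0|D0] := posnP Delta.
  have := card_sphereSS u r; rewrite D0 /= mul0n leqn0 => /eqP ->.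
  by move: IH; rewrite D0 !exp0n // addn0.
suff : #|sphere u r.+2| <= Delta.-1 * Delta ^ r.+1.
  rewrite [Delta ^ r.+2]expnS; move: IH D0; case: Delta => // D; rewrite mulSn; lia.
apply: leq_trans (card_sphereSS u r) _; rewrite leq_mul2l; apply/orP; right.
elim: r {IH} => [|r IH]; first by rewrite expn1 card_sphere1.
apply: leq_trans (card_sphereSS u r) _; rewrite expnS.
by apply: leq_mul IH; exact: leq_pred.
Qed.

(* Every vertex but the root has an edge towards the root; counted from both
   ends, these edges contribute twice. *)
Lemma sum_degree_ge : 2 * (#|T| - 1) <= \sum_u degree e u.
Proof.
have [->|/card_gt0P[u _]] := posnP #|T|; first by rewrite muln0.
under eq_bigr do rewrite degree_sum.
apply: (@leq_trans (\sum_v \sum_w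
    e v w * ((dist u v < dist u w) + (dist u w < dist u v)))); last first.
  apply: leq_sum => v _; apply: leq_sum => w _.
  by case: (e v w) => //; case: ltngtP.
have -> : \sum_v \sum_w e v w * ((dist u v < dist u w) + (dist u w < dist u v)) =
    2 * \sum_w \sum_v e v w * (dist u v < dist u w).
  rewrite mul2n -addnn [in X in X + _]exchange_big /= -big_split /=; apply: eq_bigr => v _.
  rewrite -big_split /=; apply: eq_bigr => w _.
  by rewrite mulnDr e_simple.1.
rewrite leq_mul2l /= -sum1_card (bigD1 u) //= addKn [leqRHS](bigD1 u) //=.
apply: leq_trans (leq_addl _ _).
apply: leq_sum => w wu; have [|z ez zw] := graph_dist_pred (e_conn u w).
  by rewrite eq_sym.
by rewrite (bigD1 z) //= ez zw.
Qed.

(** The total degree is at least [2 * Delta ^ k], while the ball of radius [k - 1] contributes about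
    half of that at most. The factor 2 from [sum_degree_ge] allows [Delta ^ k] without a constant in
    the final bound. *)
Lemma sum_degree_near u k : 2 <= Delta -> 0 < k -> Delta ^ k < #|T| ->
  4 * \sum_(v | dist u v < k) degree e v <= 3 * \sum_v degree e v.
Proof.
move=> D2; case: k => // k _ Tk.
have volk : 2 * Delta ^ k.+1 <= \sum_v degree e v.
  by apply: leq_trans sum_degree_ge; rewrite leq_mul2l subn1 -ltnS (ltn_predK Tk).
have near : \sum_(v | dist u v < k.+1) degree e v <= Delta * #|ball u k|.
  rewrite mulnC -sum_nat_const (eq_bigl (fun v => v \in ball u k)) /=; last first.
    by move=> v; rewrite inE.
  by apply: leq_sum => v _; exact: degree_le.
apply: (@leq_trans (4 * (Delta * #|ball u k|))); first by rewrite leq_mul2l.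
apply: (@leq_trans (3 * (2 * Delta ^ k.+1))); last by rewrite leq_mul2l.
(* The estimate [4 * (P + 1) <= 6 * P] used below needs [P >= 2], so radius 0 is treated apart. *)
case: k {near Tk volk} => [|k]; first by rewrite ball0 cards1 expn1; lia.
have := card_ball u k.+1; have : 2 <= Delta ^ k.+1.
  by rewrite expnS; have := expn_gt0 Delta k; nia.
rewrite [Delta ^ k.+2]expnS; move: (Delta ^ k.+1) => P P2 hb.
have h : 4 * #|ball u k.+1| <= 6 * P by lia.
have -> : 3 * (2 * (Delta * P)) = Delta * (6 * P) by lia.
by rewrite mulnCA leq_mul2l h orbT.
Qed.

End BallGrowth.

(** * Coarse maps to the symmetric group *)

Section FarPair.
Variables (R : realType) (T : finType) (e : rel T) (lam : R) (k : nat).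
Hypotheses (e_simple : simple_graph e) (e_conn : connected_graph e).
Hypotheses (D_gt1 : (1 < max_degree e)%N) (k_gt0 : (0 < k)%N).
Hypothesis T_large : (max_degree e ^ k < #|T|)%N.
Hypothesis lam_eig : second_largest_eigenvalue (transition_matrix R e) lam.
Local Notation dist := (graph_dist e).
Local Notation d u := ((degree e u)%:R : R).
Local Notation vol := (\sum_u d u).

Let T_gt1 : (1 < #|T|)%N.
Proof. by apply: leq_trans T_large; rewrite ltnS expn_gt0 (ltnW D_gt1). Qed.

Lemma sum_far u : vol / 4 <= \sum_(v | (k <= dist u v)%N) d v.
Proof.
have near : 4 * \sum_(v | (dist u v < k)%N) d v <= 3 * vol.
  by rewrite -!natr_sum -!natrM ler_nat sum_degree_near.
have : vol = \sum_(v | (dist u v < k)%N) d v + \sum_(v | (k <= dist u v)%N) d v.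
  rewrite (bigID (fun v => dist u v < k)%N) /=; congr (_ + _).
  by apply: eq_bigl => v; rewrite -leqNgt.
lra.
Qed.

(* A quarter of the pairs are far apart, so one of those has a kernel below four
   times the average. *)
Lemma far_pair_small_kernel n (f : T -> 'S_n.+2) (b : R) (m : nat) :
  0 <= b ->
  (forall u v, e u v -> (graph_dist (@cayley_tc n) (f u) (f v))%:R <= b) ->
  32 * (b / (1 - lam)) < m%:R ->
  exists u v, (k <= dist u v)%N /\ (kernel m (f u) (f v) < n.+2 * m)%N.
Proof.
move=> b0 fb bm; have lam1 := second_eigenvalue_lt1 e_simple e_conn T_gt1 lam_eig.
have vol0 := vol_gt0 R e_conn T_gt1.
apply: contrapT => H; have far u v : (k <= dist u v)%N ->
    (n.+2 * m <= kernel m (f u) (f v))%N.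
  by move=> kuv; rewrite leqNgt; apply/negP => ?; apply: H; exists u, v.
pose K u v : R := (kernel m (f u) (f v))%:R.
have KE (w : T -> T -> R) : \sum_u \sum_v w u v * K u v =
    n.+2%:R * (\sum_u \sum_v
      w u v * (hamming (marked_arc m (f u)) (marked_arc m (f v)))%:R) +
    \sum_u \sum_v w u v * (hamming (orientation (f u)) (orientation (f v)))%:R.
  rewrite mulr_sumr -big_split; apply: eq_bigr => u _ /=.
  rewrite mulr_sumr -big_split; apply: eq_bigr => v _ /=.
  by rewrite /K /kernel natrD natrM; ring.
have upper : (1 - lam) * \sum_u \sum_v d u * d v * K u v <=
    vol * \sum_u \sum_v (e u v)%:R * K u v.
  rewrite (KE (fun u v => d u * d v)) (KE (fun u v => (e u v)%:R)).
  rewrite [leLHS]mulrDr [leRHS]mulrDr.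
  apply: lerD; last exact: poincare_hamming.
  rewrite mulrCA [leRHS]mulrCA ler_pM2l ?ltr0n //; exact: poincare_hamming.
have edge : \sum_u \sum_v (e u v)%:R * K u v <= vol * (8 * n.+2%:R * b).
  rewrite mulr_suml; apply: ler_sum => u _; rewrite degreeE mulr_suml.
  apply: ler_sum => v _; case euv: (e u v); last by rewrite !mul0r.
  rewrite !mul1r.
  apply: (@le_trans _ _
    (8 * n.+2%:R * (graph_dist (@cayley_tc n) (f u) (f v))%:R)).
    by rewrite -!natrM ler_nat kernel_graph_dist.
  by rewrite ler_wpM2l ?fb // -natrM ler0n.
have lower : vol * (vol / 4 * (n.+2 * m)%:R) <= \sum_u \sum_v d u * d v * K u v.
  rewrite mulr_suml; apply: ler_sum => u _.
  rewrite [leRHS](bigID (fun v => k <= dist u v)%N) /= -[leLHS]addr0 lerD //; last first.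
    by apply: sumr_ge0 => v _; rewrite !mulr_ge0 ?ler0n.
  apply: (@le_trans _ _ (d u * ((\sum_(v | (k <= dist u v)%N) d v) * (n.+2 * m)%:R))).
    by rewrite ler_wpM2l ?ler0n // ler_wpM2r ?ler0n // sum_far.
  rewrite mulr_suml mulr_sumr; apply: ler_sum => v kuv.
  by rewrite mulrA ler_wpM2l ?mulr_ge0 ?ler0n // ler_nat far.
(* After cancellation this reads [(1 - lam) * m <= 32 * b], where 32 is the 8 of the edge bound
   times the 4 of the quarter of far pairs. *)
have {upper edge lower} : (1 - lam) * (vol * (vol / 4 * (n.+2 * m)%:R)) <=
    vol * (vol * (8 * n.+2%:R * b)).
  apply: le_trans (le_trans upper _); first by rewrite ler_pM2l // subr_gt0.
  by rewrite ler_pM2l.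
rewrite natrM.
have -> : (1 - lam) * (vol * (vol / 4 * (n.+2%:R * m%:R))) =
  vol * vol * n.+2%:R * ((1 - lam) * m%:R / 4) by ring.
have -> : vol * (vol * (8 * n.+2%:R * b)) = vol * vol * n.+2%:R * (8 * b) by ring.
rewrite ler_pM2l ?mulr_gt0 ?ltr0n // => h; move: bm.
by rewrite mulrA ltr_pdivrMr ?subr_gt0 // => bm; lra.
Qed.

End FarPair.

(** Were the graph larger, two vertices at distance at least [k] would have a small kernel, hence
    images closer than [alpha k] allows. *)
Lemma card_le_of_coarse_map (R : realType) (alpha beta : R -> R) (T : finType)
    (e : rel T) (lam : R) (n : nat) (f : T -> 'S_n.+2) (k : nat) :
  increasing_nonneg alpha -> increasing_nonneg beta -> 0 < beta 1 ->
  simple_graph e -> connected_graph e -> (1 < max_degree e)%N ->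
  second_largest_eigenvalue (transition_matrix R e) lam ->
  coarse_map_to_sym alpha beta e f ->
  647 * beta 1 / (1 - lam) <= alpha k%:R ->
  (#|T| <= max_degree e ^ k)%N.
Proof.
move=> [_ alpha_mono] [_ beta_mono] beta1 e_simple e_conn D1 lam_eig fE alphak.
rewrite leqNgt; apply/negP => T_large.
have T_gt1 : (1 < #|T|)%N.
  by apply: leq_trans T_large; rewrite ltnS expn_gt0 (ltnW D1).
have lam1 := second_eigenvalue_lt1 e_simple e_conn T_gt1 lam_eig.
have lamN1 := second_eigenvalue_geN1 e_simple e_conn T_gt1 lam_eig.
set X := beta 1 / (1 - lam); have X0 : 0 < X by rewrite divr_gt0 // subr_gt0.
have {}alphak : 647 * X <= alpha k%:R by rewrite mulrA.
(* At [k = 0] the lower bound on [alpha] would contradict the zero distance from [f u] to itself. *)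
have k0 : (0 < k)%N.
  rewrite lt0n; apply/eqP => k0; have [u _] := card_gt0P (ltnW T_gt1).
  have [+ _] := fE u u; move: alphak; rewrite k0 !graph_dist0; lra.
have f_edge u v : e u v -> (graph_dist (@cayley_tc n) (f u) (f v))%:R <= beta 1.
  move=> euv; have [_ /le_trans->//] := fE u v; apply: beta_mono; first exact: ler0n.
  by rewrite -[1]/(1%:R) ler_nat graph_dist_le //; exact: within1.
have f_far u v : (k <= graph_dist e u v)%N ->
    647 * X <= (graph_dist (@cayley_tc n) (f u) (f v))%:R.
  move=> kuv; have [h _] := fE u v; apply: le_trans alphak (le_trans _ h).
  by apply: alpha_mono; rewrite ?ler0n // ler_nat.
have far m : 32 * X < m%:R -> exists u v, (k <= graph_dist e u v)%N /\
    (kernel m (f u) (f v) < n.+2 * m)%N.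
  by apply: (far_pair_small_kernel e_simple e_conn D1 k0 T_large lam_eig) => //; exact: ltW.
have [m mX mX1] : exists2 m : nat, 32 * X < m%:R & m%:R <= 32 * X + 1.
  exists (Num.truncn (32 * X)).+1; first by rewrite truncnS_gt.
  by rewrite -natr1 lerD2r truncn_le //; rewrite mulr_ge0 // ltW.
have [u [v [kuv Kuv]]] := far m mX.
(* Distances in the Cayley graph are integers, so [beta 1 < 1] forces [f] to be constant along
   edges, hence everywhere. *)
have := f_far u v kuv; have [beta_lt1|beta_ge1] := ltP (beta 1) 1.
  have f_const x y : f x = f y.
    have /connectP[p + ->] := e_conn x y; elim: p x => //= z p IH x /andP[xz /IH <-].
    apply: (graph_dist_eq0 (@connected_cayley_tc n)); apply/eqP.
    rewrite -leqn0 -ltnS -(@ltr_nat R); exact: le_lt_trans (f_edge _ _ xz) beta_lt1.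
  by rewrite (f_const u v) graph_dist0; lra.
(* Here [beta 1 >= 1] and [1 - lam <= 2]. Thus [19 * m <= 608 * X + 19 <= 646 * X], just below the
   constant 647. *)
have X_half : 1 / 2 <= X.
  by rewrite /X ler_pdivlMr ?subr_gt0 //; lra.
have m0 : (0 < m)%N by rewrite -(ltr_nat R); lra.
have := graph_dist_kernel m0 Kuv; rewrite -(ler_nat R) natrM; lra.
Qed.

Lemma card_le2_of_max_degree_le1 (T : finType) (e : rel T) :
  simple_graph e -> connected_graph e -> (max_degree e <= 1)%N -> (#|T| <= 2)%N.
Proof.
move=> e_simple e_conn D1; have := sum_degree_ge e_simple e_conn.
have : (\sum_u degree e u <= #|T|)%N.
  rewrite -[#|T|]sum1_card; apply: leq_sum => u _.
  exact: leq_trans (degree_le e u) D1.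
lia.
Qed.

(** * The vertex bound and the exclusion of expanders *)

Local Open Scope classical_set_scope.
Local Open Scope ring_scope.

Theorem corollary1 (R : realType) :
  (~ exists (T : nat -> finType) (e : forall k, rel (T k)) (lam : nat -> R)
            (D : nat) (eps : R) (n : nat -> nat)
            (f : forall k, T k -> 'S_(n k).+2) (alpha beta : R -> R),
      (forall k, [/\ simple_graph (e k), connected_graph (e k),
                     (max_degree (e k) <= D)%N,
                     second_largest_eigenvalue
                       (transition_matrix R (e k)) (lam k)
                   & eps <= 1 - lam k]) /\
      0 < eps /\
      (forall N : nat, exists k, (N <= #|T k|)%N) /\
      increasing_nonneg alpha /\ increasing_nonneg beta /\
      (alpha s @[s --> +oo] --> +oo) /\
      (forall k, coarse_map_to_sym alpha beta (e k) (f k))) /\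
  (exists C : R, 0 < C /\
    forall (alpha beta : R -> R) (T : finType) (e : rel T) (lam : R)
           (n : nat) (f : T -> 'S_n.+2),
      increasing_nonneg alpha -> increasing_nonneg beta -> 0 < beta 1 ->
      alpha s @[s --> +oo] --> +oo ->
      simple_graph e -> connected_graph e -> (1 < max_degree e)%N ->
      second_largest_eigenvalue (transition_matrix R e) lam ->
      coarse_map_to_sym alpha beta e f ->
      #|T|%:R <=
        (max_degree e)%:R `^ dist_inverse alpha (C * beta 1 / (1 - lam))).
Proof.
have exceeds (alpha : R -> R) y : alpha s @[s --> +oo] --> +oo ->
    exists k : nat, y <= alpha k%:R.
  move=> /cvgryPge /(_ y) [M [_ HM]]; exists (Num.truncn M).+1.
  by apply: HM; exact: truncnS_gt.
split; last first.
  exists 647; split=> [|alpha beta T e lam n f alpha_inc beta_inc beta1].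
    by rewrite ltr0n.
  move=> /exceeds alpha_oo e_simple e_conn D1 lam_eig fE.
  set y := 647 * beta 1 / (1 - lam).
  pose P := [pred k : nat | y <= alpha k%:R].
  case: (ex_minnP (alpha_oo y : exists k, P k)) => k /= yk k_min.
  (* The infimum is attained at the least natural number [k] with [y <= alpha k], so the real power
     is a natural one. *)
  have -> : dist_inverse alpha y = k%:R.
    apply/eqP; rewrite eq_le; apply/andP; split.
      apply: ge_inf; last by exists k.
      by exists 0 => _ [j _ <-]; exact: ler0n.
    by apply: lb_le_inf; [exists k%:R, k | move=> _ [j /= /k_min kj <-]; rewrite ler_nat].
  rewrite powR_mulrn ?ler0n // -natrX ler_nat.
  exact: (card_le_of_coarse_map alpha_inc beta_inc beta1 e_simple e_conn D1 lam_eig fE).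
case=> T [e [lam [D [eps [n [f [alpha [beta [H]]]]]]]]].
case=> eps0 [T_unb [alpha_inc [beta_inc [alpha_oo fE]]]].
(* In a sequence of expanders [beta 1] may vanish; raising [beta] by 1 keeps the upper bound and
   makes its value at 1 positive. *)
have beta1_inc : increasing_nonneg (fun x => beta x + 1).
  case: beta_inc => beta0 beta_mono; split=> [x x0|x y x0 xy].
    by rewrite addr_ge0 ?beta0.
  by rewrite lerD2r beta_mono.
have beta1_gt0 : 0 < beta 1 + 1 by rewrite ltr_pwDr // beta_inc.1.
have [K alphaK] := exceeds alpha (647 * (beta 1 + 1) / eps) alpha_oo.
(* Size 3 excludes maximum degree at most 1, and [(D ^ K).+1] exceeds the bound valid for every
   graph of the sequence with larger maximum degree. *)
have [k Tk] := T_unb (maxn 3 (D ^ K).+1).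
have [e_simple e_conn e_deg lam_eig eps_lam] := H k.
have [D1|D1] := leqP (max_degree (e k)) 1.
  have := card_le2_of_max_degree_le1 e_simple e_conn D1.
  by move: Tk; rewrite geq_max; lia.
have : (#|T k| <= max_degree (e k) ^ K)%N.
  apply: (@card_le_of_coarse_map R alpha (fun x => beta x + 1) _ _ (lam k) _ (f k)) => //.
    move=> u v; have [h1 h2] := fE k u v; split => //.
    by apply: le_trans h2 _; rewrite lerDl.
  apply: le_trans alphaK; rewrite ler_pM2l; last by rewrite mulr_gt0 ?ltr0n.
  rewrite lef_pV2 // posrE.
  exact: lt_le_trans eps0 eps_lam.
have : (max_degree (e k) ^ K <= D ^ K)%N.
  by have [->|K0] := posnP K; rewrite // leq_exp2r.
by move: Tk; rewrite geq_max; lia.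
Qed.
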